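(* For every nonzero cardinal $\kappa\le\mathfrak{c}$, the Hilbert space $\ell_2(\kappa)$ contains a closed discrete Banakh subgroup $H$ of cardinality $|H|=\max\{\kappa,\omega\}$ whose $\mathbb{Q}$-linear hull is a dense Banakh subgroup of $\ell_2(\kappa)$.
   Context: $\mathfrak{c}$ is the cardinality of the continuum, $\omega$ the first infinite cardinal. $\ell_2(\kappa)$ is the real Hilbert space of all functions $x:\kappa\to\mathbb{R}$ with $\sum_{\alpha\in\kappa}|x(\alpha)|^2<\infty$, with inner product $\langle x|y\rangle=\sum_{\alpha\in\kappa}x(\alpha)y(\alpha)$, norm $\|x\|=\sqrt{\langle x|x\rangle}$ and metric $d(x,y)=\|x-y\|$. A subgroup is a nonempty subset $X$ with $X-X\subseteq X$. The $\mathbb{Q}$-linear hull of a subset $X\subseteq\ell_2(\kappa)$ is the smallest $\mathbb{Q}$-linear subspace of $\ell_2(\kappa)$ containing $X$. For a metric space $(X,d)$, $d[X^2]=\{d(x,y):x,y\in X\}$ and $\mathsf{S}(c;r)=\{x\in X:d(x,c)=r\}$. A metric space $(X,d)$ is a Banakh space if for every $c\in X$ and every $r\in d[X^2]$ there exist points $x,y\in X$ such that $\mathsf{S}(c;r)=\{x,y\}$ and $d(x,y)=2r$. A subgroup of $\ell_2(\kappa)$ is called Banakh if it is a Banakh space with respect to the metric inherited from $\ell_2(\kappa)$. *)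

(* Defs.v *)
From HB Require Import structures.
From mathcomp Require Import all_boot all_order all_algebra.
From mathcomp Require Import ring lra.
From mathcomp Require Import mathcomp_extra boolp classical_sets functions.
From mathcomp Require Import cardinality fsbigop reals ereal topology normedtype.
From mathcomp Require Import numfun esum.

Set Implicit Arguments.
Unset Strict Implicit.
Unset Printing Implicit Defensive.
Import Order.TTheory GRing.Theory Num.Theory.
Import numFieldNormedType.Exports.

Local Open Scope classical_set_scope.
Local Open Scope card_scope.
Local Open Scope ring_scope.

Section sum_of_squares.
Context {R : realType} {K : choiceType}.
Implicit Types f g : K -> R.

Definition sumsq f : \bar R := (\esum_(i in [set: K]) (f i ^+ 2)%:E)%E.

Lemma sumsq_ge0 f : (0 <= sumsq f)%E.
Proof. by apply: esum_ge0 => i _; rewrite lee_fin sqr_ge0. Qed.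

Lemma sumsq_cst0 : sumsq (fun=> 0) = 0%E.
Proof. by apply: esum1 => i _; rewrite expr0n. Qed.

Lemma sqr_le_sumsq f i : ((f i ^+ 2)%:E <= sumsq f)%E.
Proof.
apply: esum_ge; exists [set i]; first by split=> //; exact: finite_set1.
by rewrite fsbig_set1.
Qed.

Lemma sumsq_eq0 f : sumsq f = 0%E -> forall i, f i = 0.
Proof.
move=> f0 i; have := sqr_le_sumsq f i; rewrite f0 lee_fin => fi0.
by apply/eqP; rewrite -sqrf_eq0 eq_le fi0 sqr_ge0.
Qed.

Lemma sumsqZ (a : R) f : sumsq (fun i => a * f i) = ((a ^+ 2)%:E * sumsq f)%E.
Proof.
have leZ (b : R) g : (sumsq (fun i => (b * g i)%R) <= (b ^+ 2)%:E * sumsq g)%E.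
  rewrite /sumsq; apply: ge_ereal_sup => _ [A [finA _] <-].
  under eq_fsbigr do rewrite exprMn EFinM.
  rewrite -ge0_mule_fsumr; last by move=> i; rewrite lee_fin sqr_ge0.
  apply: lee_wpmul2l; first by rewrite lee_fin sqr_ge0.
  by apply: esum_ge; exists A.
apply/eqP; rewrite eq_le leZ/=.
have [->|a0] := eqVneq a 0.
  by rewrite expr0n/= mul0e sumsq_ge0.
have a20 : 0 < a ^+ 2 by rewrite exprn_even_gt0.
rewrite -lee_pdivlMl// -exprVn.
apply: le_trans (leZ _ _); rewrite /sumsq le_eqVlt; apply/orP; left.
by apply/eqP; apply: eq_esum => i _; rewrite mulKf.
Qed.

Lemma sumsqD_le (t : R) f g : 0 < t ->
  (sumsq (fun i => (f i + g i)%R) <=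
   (1 + t)%:E * sumsq f + (1 + t^-1)%:E * sumsq g)%E.
Proof.
move=> t0.
have c1 : 0 <= 1 + t by lra.
have c2 : 0 <= 1 + t^-1 by have := t0; rewrite -invr_gt0; lra.
rewrite -[X in (_ <= X%:E * _ + _)%E](sqr_sqrtr c1).
rewrite -[X in (_ <= _ + X%:E * _)%E](sqr_sqrtr c2).
rewrite -!sumsqZ /sumsq -esumD; last 2 first.
- by move=> i _; rewrite lee_fin sqr_ge0.
- by move=> i _; rewrite lee_fin sqr_ge0.
apply: le_esum => i _; rewrite -EFinD lee_fin !exprMn !sqr_sqrtr//.
have [s [s0 st]] : exists s : R, 0 < s /\ t = s ^+ 2.
  by exists (Num.sqrt t); rewrite sqrtr_gt0 t0 sqr_sqrtr// ltW.
have : 0 <= (s * f i - s^-1 * g i) ^+ 2 by rewrite sqr_ge0.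
rewrite sqrrB !exprMn exprVn -st mulrACA divff ?gt_eqF// mul1r.
rewrite sqrrD !mulrDl !mul1r; lra.
Qed.

End sum_of_squares.

Section l2_type.
Variables (R : realType) (K : choiceType).

(* The real Hilbert space l2(kappa), where kappa is the cardinal of K. *)
Definition l2_pred : {pred K -> R} := fun f => (sumsq f < +oo)%E.

Record l2 := L2 { l2_val :> K -> R ; _ : l2_val \in l2_pred }.

HB.instance Definition _ := [isSub for l2_val].
HB.instance Definition _ := [Choice of l2 by <:].

Lemma l2_submod_closed : submod_closed l2_pred.
Proof.
split=> [|a f g]; rewrite !unfold_in.
  by rewrite [X in (X < _)%E](_ : _ = 0%E) ?ltry//; exact: sumsq_cst0.
move=> foo goo.
apply: (@le_lt_trans _ _ ((1 + 1)%:E * sumsq (fun i => (a * f i)%R) +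
   (1 + 1^-1)%:E * sumsq g)%E).
  exact: (@sumsqD_le _ _ 1 (fun i => a * f i) g).
rewrite sumsqZ lte_add_pinfty ?lte_mul_pinfty// ?lee_fin ?sqr_ge0//.
Qed.

HB.instance Definition _ :=
  GRing.isSubmodClosed.Build R _ l2_pred l2_submod_closed.
HB.instance Definition _ := [SubChoice_isSubLmodule of l2 by <:].

(* [esum] is the supremum of the finite subsums, which is the sum only for
   nonnegative families: hence the positive and negative parts. *)
Definition l2_dot (x y : l2) : R :=
  let p j := (x j * y j)%:E in
  fine (\esum_(i in [set: K]) p^\+ i)%E - fine (\esum_(i in [set: K]) p^\- i)%E.

Definition l2_norm (x : l2) : R := Num.sqrt (l2_dot x x).

Lemma sumsq_fin (x : l2) : sumsq x \is a fin_num.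
Proof.
by rewrite ge0_fin_numE ?sumsq_ge0//; case: x => x /= xP; rewrite unfold_in in xP.
Qed.

Lemma l2_dotxx (x : l2) : l2_dot x x = fine (sumsq x).
Proof.
rewrite /l2_dot /sumsq [X in fine X - _](_ : _ = sumsq x); last first.
  apply: eq_esum => i _; rewrite (@ge0_funeposE _ _ setT) ?inE//=.
  by move=> j _; rewrite lee_fin -expr2 sqr_ge0.
rewrite [X in _ - fine X](_ : _ = 0%E) ?subr0//.
apply: esum1 => i _; rewrite (@ge0_funenegE _ _ setT) ?inE//=.
by move=> j _; rewrite lee_fin -expr2 sqr_ge0.
Qed.

Lemma l2_norm_ge0 (x : l2) : 0 <= l2_norm x.
Proof. exact: sqrtr_ge0. Qed.

Lemma sumsqE (x : l2) : sumsq x = (l2_norm x ^+ 2)%:E.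
Proof.
by rewrite /l2_norm l2_dotxx sqr_sqrtr ?fineK ?sumsq_fin// fine_ge0 ?sumsq_ge0.
Qed.

Lemma l2_norm0_eq0 (x : l2) : l2_norm x = 0 -> x = 0.
Proof.
move=> x0; apply/val_inj/funext => i /=; apply: sumsq_eq0.
by rewrite sumsqE x0 expr0n.
Qed.

Lemma l2_normZ (a : R) (x : l2) : l2_norm (a *: x) = `|a| * l2_norm x.
Proof.
rewrite /l2_norm !l2_dotxx -sqrtr_sqr -sqrtrM ?sqr_ge0//; congr Num.sqrt.
rewrite -[sumsq (a *: x)]/(sumsq (fun i => a * x i)) sumsqZ fineM//.
exact: sumsq_fin.
Qed.

Lemma l2_normD (x y : l2) : l2_norm (x + y) <= l2_norm x + l2_norm y.
Proof.
have [/l2_norm0_eq0 ->|x0] := eqVneq (l2_norm x) 0.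
  by rewrite add0r lerDr l2_norm_ge0.
have [/l2_norm0_eq0 ->|y0] := eqVneq (l2_norm y) 0.
  by rewrite addr0 lerDl l2_norm_ge0.
have {}x0 : 0 < l2_norm x by rewrite lt_def x0 l2_norm_ge0.
have {}y0 : 0 < l2_norm y by rewrite lt_def y0 l2_norm_ge0.
rewrite -(@ler_pXn2r _ 2)// ?nnegrE ?addr_ge0 ?l2_norm_ge0//.
rewrite -lee_fin -sumsqE.
apply: le_trans (@sumsqD_le _ _ (l2_norm y / l2_norm x) x y _) _.
  by rewrite divr_gt0.
rewrite !sumsqE -!EFinM -EFinD lee_fin le_eqVlt; apply/orP; left; apply/eqP.
by field; rewrite !gt_eqF.
Qed.

HB.instance Definition _ :=
  @Lmodule_isNormed.Build R l2 l2_norm l2_normD l2_normZ l2_norm0_eq0.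

Lemma l2_normE (x : l2) : `|x| = Num.sqrt (l2_dot x x).
Proof. by []. Qed.

Definition l2_dist (x y : l2) : R := `|x - y|.

Lemma l2_dist_ge0 x y : 0 <= l2_dist x y.
Proof. exact: normr_ge0. Qed.

Lemma l2_dist_positivity x y : l2_dist x y = 0 -> x = y.
Proof. by move=> /normr0_eq0 /subr0_eq. Qed.

Lemma l2_ballE (x : l2) (e : R) : ball x e = [set y | l2_dist x y < e].
Proof. by rewrite -ball_normE. Qed.

HB.instance Definition _ := @PseudoMetric_isMetric.Build R l2
  l2_dist l2_dist_ge0 l2_dist_positivity l2_ballE.

End l2_type.

Section metric_subspace.
Context {R : realType} {X : metricType R} (A : set X).

Let dist (x y : A) : R := mdist (set_val x) (set_val y).

Let dist_ge0 x y : 0 <= dist x y.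
Proof. exact: mdist_ge0. Qed.

Let dist_positivity x y : dist x y = 0 -> x = y.
Proof. by move=> /mdist_positivity xy; apply: val_inj; rewrite -!set_valE. Qed.

Let ballEdist (x : A) e : ball x e = [set y | dist x y < e].
Proof. by rewrite -initial_ballE ballEmdist. Qed.

HB.instance Definition _ := @PseudoMetric_isMetric.Build R (set_type A)
  dist dist_ge0 dist_positivity ballEdist.

End metric_subspace.

Definition distance_set {R : realType} (X : metricType R) : set R :=
  [set r | exists x y : X, r = mdist x y].

Definition sphere {R : realType} {X : metricType R} (c : X) (r : R) : set X :=
  [set x | mdist x c = r].

Definition Banakh_space {R : realType} (X : metricType R) : Prop :=
  forall (c : X) (r : R), distance_set X r ->
    exists x y : X, sphere c r = [set x; y] /\ mdist x y = 2 * r.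

Definition subgroup {V : zmodType} (A : set V) : Prop :=
  A !=set0 /\ forall x y, A x -> A y -> A (x - y).

Definition Q_subspace {R : realType} {V : lmodType R} (A : set V) : Prop :=
  [/\ A 0, forall x y, A x -> A y -> A (x + y) &
      forall (q : rat) x, A x -> A (ratr q *: x)].

Definition Q_hull {R : realType} {V : lmodType R} (A : set V) : set V :=
  smallest Q_subspace A.

Definition Banakh_subgroup {R : realType} {K : choiceType} (A : set (l2 R K)) :=
  subgroup A /\ Banakh_space (set_type A).

(* The subspace topology on A is discrete iff all points of A are isolated. *)
Definition discrete_set {T : topologicalType} (A : set T) : Prop :=
  A `<=` isolated A.

(* |A| = max{|B|, |C|}, any two cardinals being comparable. *)
Definition card_eq_max {T U V} (A : set T) (B : set U) (C : set V) : Prop :=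
  (C #<= B -> A #= B) /\ (B #<= C -> A #= C).

(* Main.v *)
Require Import Defs.
From HB Require Import structures.
From mathcomp Require Import all_boot all_order all_algebra.
From mathcomp Require Import ring lra zify.
From mathcomp Require Import mathcomp_extra boolp classical_sets functions.
From mathcomp Require Import cardinality fsbigop reals ereal topology normedtype.
From mathcomp Require Import numfun esum.

(* For t real, let b_t be the sum of 2^-(3^k) over all k such that the k-th
   rational is below t. The sparsity of the binary digits gives a Liouville
   argument: if X and Y are integer combinations of such numbers and X * Y is an
   integer N, then eventually the products of their partial sums equal N exactly,
   which is impossible unless X or Y is the trivial combination.

   Choose distinct reals t_a (a in K), an index k0, and let H be the group
   generated by v_k0 = b_(t_k0) e_k0 and v_a = e_a + b_(t_a) e_k0 for a != k0. The
   squared norm of \sum n_a v_a is (\sum n_a b_(t_a))^2 + \sum_(a != k0) n_a^2. If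
   x and y in H have the same norm, then the k0-coordinates of x - y and x + y
   have an integer product, whence x = y or x = - y: this is the Banakh property,
   and it passes to the Q-hull by clearing denominators. Nonzero elements of H
   have norm at least min(1, b_(t_k0)), so H is closed and discrete, and the
   closure of the Q-hull contains every e_a. *)

Set Implicit Arguments.
Unset Strict Implicit.
Unset Printing Implicit Defensive.
Import Order.TTheory GRing.Theory Num.Theory.
Import numFieldNormedType.Exports.

Local Open Scope classical_set_scope.
Local Open Scope card_scope.
Local Open Scope ring_scope.

(** * Cardinal arithmetic *)

Section set_injections.
Context {T : Type}.
Implicit Types A B : set T.

Lemma set_inj_rel A B (F : T -> T -> Prop) :
    (forall a, A a -> exists2 b, B b & F a b) ->
    (forall a a' b, F a b -> F a' b -> a = a') ->
  exists2 f : T -> T, set_fun A B f & set_inj A f.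
Proof.
move=> FT Finj.
have /choice[f fP] a : exists b, A a -> B b /\ F a b.
  have [/FT[b Bb Fab]|nAa] := pselect (A a); first by exists b.
  by exists a.
exists f => [a /fP[]//|a a' /set_mem /fP[_ Fa] /set_mem /fP[_ Fa'] ff].
by apply: Finj Fa _; rewrite ff.
Qed.

(** By Zorn's lemma there is a maximal partial bijection between [A] and [B]. If it missed both a
    point [a] of [A] and a point [b] of [B], the pair [(a, b)] could be added; so it is total on one
    side. *)
Lemma set_inj_total A B :
  (exists2 f : T -> T, set_fun A B f & set_inj A f) \/
  (exists2 f : T -> T, set_fun B A f & set_inj B f).
Proof.
pose P (F : set (T * T)) := F `<=` A `*` B /\
  forall p q, F p -> F q -> (p.1 = q.1 <-> p.2 = q.2).
have [C CP totC|F [[FAB Fbij] Fmax]] := @Zorn_bigcup _ P.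
  split=> [p [F /CP[+ _] Fp]|p q [F CF Fp] [G CG Gq]]; first exact.
  have [FG|GF] := totC _ _ CF CG.
    by have [_] := CP _ CG; apply => //; exact: FG.
  by have [_] := CP _ CF; apply => //; exact: GF.
have [[a [Aa aF]]|domF] := pselect (exists a, A a /\ forall b, ~ F (a, b)); last first.
  left; apply: (@set_inj_rel A B (fun a b => F (a, b))).
    move=> a Aa; apply: contrapT => h; apply: domF; exists a; split=> // b Fab.
    by apply: h; exists b => //; have [] := FAB _ Fab.
  by move=> a a' b Fa Fa'; apply/(Fbij _ _ Fa Fa').
have [[b [Bb bF]]|ranF] := pselect (exists b, B b /\ forall a, ~ F (a, b)); last first.
  right; apply: (@set_inj_rel B A (fun b a => F (a, b))).
    move=> b Bb; apply: contrapT => h; apply: ranF; exists b; split=> // a' Fab.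
    by apply: h; exists a' => //; have [] := FAB _ Fab.
  by move=> b b' a' Fa Fa'; apply/(Fbij _ _ Fa Fa').
exfalso; apply: (Fmax (F `|` [set (a, b)])).
  by split=> [|/(_ (a, b) (or_intror erefl))]; [exact: subsetUl|exact: aF].
split=> [p [/FAB//|->//]|[x y] [x' y'] /= [Fp|[-> ->]] [Fq|[-> ->]] //=].
- exact: Fbij Fp Fq.
- split=> E; subst; first by case: (aF y).
  by case: (bF x).
- split=> E; subst; first by case: (aF y').
  by case: (bF x').
Qed.

End set_injections.

Lemma infinite_inj_nat T : infinite_set [set: T] -> exists e : nat -> T, injective e.
Proof.
elim/Ppointed: T => T; first by rewrite emptyE => /(_ (finite_set0 _)).
by move=> /infiniteP/pcard_injP[e ei]; exists e; apply: in2TT.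
Qed.

Section infinite_square.
Context {T : Type}.

Let dom (F : set (T * T * T)) : set T := [set a | exists b c, F (a, b, c)].

(** [F] is a possibly multivalued graph of an injection of [dom F * dom F] into [dom F], in a form
    stable under unions of chains; [square_inj_fun] chooses one value per pair. *)
Let square_inj (F : set (T * T * T)) :=
  [/\ forall a b c, F (a, b, c) -> dom F b /\ dom F c,
      forall a b, dom F a -> dom F b -> exists c, F (a, b, c) &
      forall a b a' b' c, F (a, b, c) -> F (a', b', c) -> a = a' /\ b = b'].

Let dom_sub F G : F `<=` G -> dom F `<=` dom G.
Proof. by move=> FG a [b [c Fabc]]; exists b, c; apply: FG. Qed.

Let square_inj_bigcup (C : set (set (T * T * T))) :
  C `<=` square_inj -> total_on C subset -> square_inj (\bigcup_(F in C) F).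
Proof.
move=> CP totC; split.
- move=> a b c [F CF Fabc]; have [/(_ _ _ _ Fabc)[b' c'] _ _] := CP _ CF.
  by split; apply: dom_sub b' || apply: dom_sub c'; exact: bigcup_sup.
- move=> a b [a1 [a2 [F CF Fa]]] [b1 [b2 [G CG Gb]]].
  have Fda : dom F a by exists a1, a2.
  have Gdb : dom G b by exists b1, b2.
  have [FG|GF] := totC _ _ CF CG.
    have [_ /(_ a b (dom_sub FG Fda) Gdb)[c Gc] _] := CP _ CG.
    by exists c, G.
  have [_ /(_ a b Fda (dom_sub GF Gdb))[c Fc] _] := CP _ CF.
  by exists c, F.
- move=> a b a' b' c [F CF Fa] [G CG Ga].
  have [FG|GF] := totC _ _ CF CG.
    by have [_ _] := CP _ CG; apply; [apply: FG Fa|].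
  by have [_ _] := CP _ CF; apply; [|apply: GF Ga].
Qed.

Let square_inj_fun F : square_inj F -> exists2 phi : T * T -> T,
    forall a b, dom F a -> dom F b -> dom F (phi (a, b)) &
    forall a b a' b', dom F a -> dom F b -> dom F a' -> dom F b' ->
      phi (a, b) = phi (a', b') -> a = a' /\ b = b'.
Proof.
move=> [Fdom Fsq Finj].
have /choice[phi phiF] (p : T * T) :
    exists c, dom F p.1 -> dom F p.2 -> F (p.1, p.2, c).
  have [F1|] := pselect (dom F p.1); last by exists p.1.
  have [F2|] := pselect (dom F p.2); last by exists p.1.
  by have [c Fc] := Fsq _ _ F1 F2; exists c.
exists phi => [a b Fa Fb|a b a' b' Fa Fb Fa' Fb' E].
  by have /Fdom[] := phiF (a, b) Fa Fb.
by apply: Finj (phiF (a, b) Fa Fb) _; rewrite E; exact: (phiF (a', b')).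
Qed.

(* If A injects into its complement by [h], an injection A * A -> A extends to
   A U h A: the new pairs (A * h A) U (h A * A) U (h A * h A) are sent
   into h A through three disjoint copies of A inside A * A. *)
Let square_inj_extend F (e : nat -> T) (h : T -> T) :
    square_inj F -> injective e -> (forall n, dom F (e n)) ->
    set_fun (dom F) (~` dom F) h -> set_inj (dom F) h ->
  exists G, F `<` G /\ square_inj G.
Proof.
move=> [Fdom Fsq Finj] e_inj eF hF h_inj.
have h_injE a b : dom F a -> dom F b -> h a = h b -> a = b.
  by move=> Fa Fb; apply: h_inj; exact: mem_set.
have [phi phiD phi_inj] := square_inj_fun (And3 Fdom Fsq Finj).
pose sel (i : bool) a := if i then h a else a.
have selD i a : dom F a -> dom F (sel i a) -> i = false.
  by case: i => // Fa /(hF _ Fa).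
have sel_inj i j a b : dom F a -> dom F b -> sel i a = sel j b -> i = j /\ a = b.
  move=> Fa Fb; case: i j => [] [] /=; rewrite /sel.
  - by move/h_injE => ->.
  - by move=> E; case: (hF _ Fa); rewrite E.
  - by move=> E; case: (hF _ Fb); rewrite -E.
  - by [].
pose w (i j : bool) := e (pickle (i, j)).
have wD i j : dom F (w i j) by exact: eF.
pose new a b i j := (sel i a, sel j b, h (phi (w i j, phi (a, b)))).
pose G := F `|` [set x | exists a b i j,
  [/\ dom F a, dom F b, i || j & x = new a b i j]].
have newG a b i j : dom F a -> dom F b -> i || j -> G (new a b i j).
  by move=> Fa Fb ij; right; exists a, b, i, j.
have [a0 Fa0] : dom F !=set0 by exists (e 0%N).
have FG : F `<=` G by exact: subsetUl.
have domG x : dom G x <-> exists i a, dom F a /\ x = sel i a.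
  split=> [[b [c [Fx|]]]|[[] [a [Fa ->]]]].
  - by exists false, x; split=> //; exists b, c.
  - by move=> [a [b' [i [j [Fa Fb _ [-> _ _]]]]]]; exists i, a.
  - by exists a0, (h (phi (w true false, phi (a, a0)))); exact: (newG a a0 true false).
  - exact: dom_sub Fa.
exists G; split; first split=> // GF.
  have /GF Fn := newG _ _ _ _ Fa0 Fa0 (isT : true || true).
  have : dom F (h a0) by exists (h a0); eexists; exact: Fn.
  exact: hF.
split.
- move=> x y z [/Fdom[Fy Fz]|]; first by split; exact: dom_sub FG _ _.
  move=> [a [b [i [j [Fa Fb _ [_ -> ->]]]]]]; split; apply/domG.
    by exists j, b.
  by exists true, (phi (w i j, phi (a, b))); split=> //; apply: (phiD) => //; exact: phiD.
- move=> x y /domG[i [a [Fa ->]]] /domG[j [b [Fb ->]]].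
  have [ij|] := boolP (i || j); first by eexists; exact: (newG a b i j).
  case: i j => [] [] // _.
  by have [c Fc] := Fsq _ _ Fa Fb; exists c; left.
- have new_not_F a b i j x y : dom F a -> dom F b -> i || j ->
      ~ F (x, y, h (phi (w i j, phi (a, b)))).
    by move=> Fa Fb ij /Fdom[_]; apply: hF; apply: (phiD) => //; exact: phiD.
  move=> x y x' y' z [Fx|[a [b [i [j [Fa Fb ij [-> -> ->]]]]]]].
    move=> [|[a [b [i [j [Fa Fb ij [_ _ zE]]]]]]]; first exact: Finj Fx.
    by move: Fx; rewrite zE => /new_not_F; case.
  move=> [|[a' [b' [i' [j' [Fa' Fb' ij' [-> -> ]]]]]]]; first by move/new_not_F; case.
  have [Dab Dab'] : dom F (phi (a, b)) /\ dom F (phi (a', b')) by split; exact: phiD.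
  move=> /h_injE E; have /phi_inj[] := E (phiD _ _ (wD _ _) Dab) (phiD _ _ (wD _ _) Dab').
  - exact: wD.
  - exact: Dab.
  - exact: wD.
  - exact: Dab'.
  move=> /e_inj /(pcan_inj pickleK)[-> ->].
  by move=> /phi_inj[]// -> ->.
Qed.

(** A Zorn-maximal [F] above an injection on a countable set cannot be extended, so [dom F] does not
    inject into its complement. By comparability the complement injects into [dom F]; hence so does
    all of [T], and the pairing on [dom F] transfers to [T]. *)
Lemma infinite_square : infinite_set [set: T] ->
  exists f : T * T -> T, injective f.
Proof.
move=> /infinite_inj_nat[e e_inj].
pose F0 : set (T * T * T) := [set x | exists i j, x = (e i, e j, e (pickle (i, j)))].
have domF0 n : dom F0 (e n) by exists (e 0%N), (e (pickle (n, 0%N))), n, 0%N.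
have F0sq : square_inj F0.
  split=> [a b c [i [j [_ -> ->]]] //||].
    move=> a b [_ [_ [i [_ [-> _ _]]]]] [_ [_ [j [_ [-> _ _]]]]].
    by exists (e (pickle (i, j))), i, j.
  move=> a b a' b' c [i [j [-> -> ->]]] [i' [j' [-> -> /e_inj]]].
  by move=> /(pcan_inj pickleK)[-> ->].
(* The union of the empty chain must satisfy [P], so containing [F0] is asked of nonempty [F]
   only. *)
pose P F := square_inj F /\ (F !=set0 -> F0 `<=` F).
have [C CP totC|F [[Fsq F0F] Fmax]] := @Zorn_bigcup _ P.
  split; first by apply: square_inj_bigcup => // F /CP[].
  move=> [x [F CF Fx]]; have [_ F0F] := CP _ CF.
  by apply: subset_trans (F0F _) _; [exists x|exact: bigcup_sup].
have {}F0F : F0 `<=` F.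
  apply: F0F; apply/set0P/eqP => F_0.
  have F0n : F0 (e 0%N, e 0%N, e (pickle (0%N, 0%N))) by exists 0%N, 0%N.
  apply: (Fmax F0); last by split=> // _; exact: subset_refl.
  by rewrite F_0; split=> // /(_ _ F0n).
have eF n : dom F (e n) by exact: dom_sub F0F _ _.
have [[h hF h_inj]|[g gF g_inj]] := set_inj_total (dom F) (~` dom F).
  have [G [FG Gsq]] := square_inj_extend Fsq e_inj eF hF h_inj.
  case: (Fmax _ FG); split=> // _.
  exact: subset_trans F0F (properW FG).
have [phi phiD phi_inj] := square_inj_fun Fsq.
(* The tags [e 0] and [e 1] keep the images of [dom F] and of its complement disjoint. *)
pose u x := if pselect (dom F x) then phi (e 0%N, x) else phi (e 1%N, g x).
have uD x : dom F (u x).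
  by rewrite /u; case: pselect => Fx; apply: phiD => //; exact: gF.
have u_inj : injective u.
  move=> x y; rewrite /u; case: pselect => Fx; case: pselect => Fy.
  - by move=> /phi_inj[].
  - by move=> /phi_inj[||||/e_inj]//; exact: gF.
  - by move=> /phi_inj[||||/e_inj]//; exact: gF.
  - move=> /phi_inj[||||_]//; [exact: gF|exact: gF|].
    by apply: g_inj; exact: mem_set.
exists (fun p => phi (u p.1, u p.2)) => -[a b] [a' b'] /=.
by move=> /phi_inj[]// /u_inj-> /u_inj->.
Qed.

End infinite_square.

(** A list is encoded by folding the pairing; its length is stored as well, so that decoding knows
    where to stop. *)
Lemma infinite_seq_inj (T : Type) : infinite_set [set: T] ->
  exists f : seq (T * int) -> T, injective f.
Proof.
move=> Tinf; have [f f_inj] := infinite_square Tinf.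
have [e e_inj] := infinite_inj_nat Tinf.
pose enc (s : seq (T * int)) :=
  foldr (fun p x => f (f (p.1, e (pickle p.2)), x)) (e 0%N) s.
exists (fun s => f (e (size s), enc s)) => s t /f_inj[/e_inj st].
elim: s t st => [|[a n] s IHs] [|[b m] t]//= [st].
move=> /f_inj[/f_inj[-> /e_inj /(pcan_inj pickleK) ->]].
by move=> /(IHs _ st) ->.
Qed.

(** * Lacunary series *)

Section lacunary_series.
Context {R : realType}.

(** Exponents triple so that a tail, of order [lac n ^+ 3], is negligible against [lac n ^+ 2], the
    grid containing the products of two partial sums up to index [n]. *)
Definition lac (n : nat) : R := 2^-1 ^+ (3 ^ n).

Lemma lac_gt0 n : 0 < lac n.
Proof. by rewrite exprn_gt0// invr_gt0. Qed.

Lemma lacS n : lac n.+1 = lac n ^+ 3.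
Proof. by rewrite /lac expnSr exprM. Qed.

Lemma lac_le_half n : lac n <= 2^-1.
Proof.
rewrite /lac -[leRHS]expr1 ler_wiXn2l ?invr_ge0 ?invf_le1 ?ler1n//.
by rewrite expn_gt0.
Qed.

Lemma lac_small (D : R) : exists M, forall n, (M <= n)%N -> D * lac n < 1.
Proof.
exists (Num.bound D) => n Mn.
rewrite /lac exprVn -ltr_pdivlMr ?invr_gt0 ?exprn_gt0// mul1r invrK.
apply: lt_le_trans (upper_nthrootP Mn) _.
by rewrite ler_weXn2l ?ler1n// ltnW// ltn_expl.
Qed.

Definition lacsum (c : nat -> int) n : R := \sum_(k < n) (c k)%:~R * lac k.

Lemma lacsumS c n : lacsum c n.+1 = lacsum c n + (c n)%:~R * lac n.
Proof. by rewrite /lacsum big_ord_recr. Qed.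

(** The sum stops at the term of index [n], and the denominators of all its terms divide the power
    of two [(lac n)^-1]. *)
Lemma lacsum_int c n : lacsum c n.+1 / lac n \is a Num.int.
Proof.
elim: n => [|n IHn].
  by rewrite lacsumS /lacsum big_ord0 add0r mulfK ?gt_eqF ?lac_gt0// intr_int.
rewrite lacsumS mulrDl mulfK ?gt_eqF ?lac_gt0// rpredD ?intr_int//.
rewrite lacS exprS invfM mulrA rpredM// -exprVn rpredX//.
by rewrite /lac exprVn invrK rpredX// (intr_int _ 2).
Qed.

(** A nonzero sum up to index [n] is at least [lac n] in absolute value, and the next term, at most
    [C * lac n ^+ 3], cannot cancel it. So for large [n] nonzero sums stay nonzero, and a nonzero
    digit produces a first one. *)
Lemma lacsum_eventually_neq0 c (C : R) :
    (forall k, `|(c k)%:~R| <= C) ->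
    (forall N, exists2 n, (N <= n)%N & c n != 0) ->
  exists M, forall n, (M <= n)%N -> lacsum c n != 0.
Proof.
move=> cC cio.
have [M MC] := lac_small C.
have step n : (M <= n)%N -> lacsum c n.+1 != 0 -> lacsum c n.+2 != 0.
  move=> Mn x0; have /(norm_intr_ge1 (lacsum_int c n)) : lacsum c n.+1 / lac n != 0.
    by rewrite mulf_neq0// invr_eq0 gt_eqF ?lac_gt0.
  rewrite normrM normfV (gtr0_norm (lac_gt0 n)) ler_pdivlMr ?lac_gt0// mul1r => xe.
  rewrite lacsumS; apply/eqP => /addr0_eq xE.
  move: xe; rewrite -normrN xE normrM (gtr0_norm (lac_gt0 _)) lacS => xe.
  have := MC _ Mn; have := lac_le_half n; have := lac_gt0 n; have := cC n.+1.
  move: xe; set e := lac n; set a := `|_| => xe aC e0 e2 Ce.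
  have : a * e ^+ 3 <= C * e ^+ 3 by rewrite ler_wpM2r// exprn_ge0// ltW.
  have : C * e ^+ 3 = (C * e) * e ^+ 2 by ring.
  have : (C * e) * e ^+ 2 <= e ^+ 2 by rewrite ler_piMl ?sqr_ge0// ltW.
  have : e ^+ 2 <= 2^-1 * e by rewrite expr2 ler_wpM2r// ltW.
  lra.
have [n Mn cn] := cio M.+1.
exists n.+1 => m nm; rewrite -(subnK nm); elim: (m - n.+1)%N => [|k IHk].
  rewrite add0n; case: n Mn cn {nm} => // n; rewrite ltnS => Mn cn.
  have [x0|x0] := eqVneq (lacsum c n.+1) 0; last exact: step.
  by rewrite lacsumS x0 add0r mulf_neq0 ?intr_eq0// gt_eqF ?lac_gt0.
rewrite addSn addnS; apply: step; last by rewrite -addnS.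
lia.
Qed.

Lemma lac_product_not_int (c d : nat -> int) (C X Y : R) :
    (forall k, `|(c k)%:~R| <= C) -> (forall k, `|(d k)%:~R| <= C) ->
    (forall N, exists2 n, (N <= n)%N & c n != 0) ->
    (forall N, exists2 n, (N <= n)%N & d n != 0) ->
    (forall n, `|X - lacsum c n| <= C * lac n) ->
    (forall n, `|Y - lacsum d n| <= C * lac n) ->
  X * Y \isn't a Num.int.
Proof.
move=> cC dC cio dio Xc Yd; apply/negP => XY.
have C0 : 0 <= C by apply: le_trans (cC 0%N).
have [Mx xn0] := lacsum_eventually_neq0 cC cio.
have [My yn0] := lacsum_eventually_neq0 dC dio.
have [M1 M1P] := lac_small (C * (`|X| + `|Y| + C)).
have [M2 M2P] := lac_small (C ^+ 2).
(* The difference of the two sides is an integer multiple of [lac n ^+ 2] of order [lac n ^+ 3], so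
   it vanishes for large [n]. *)
have prodE n : (M1 <= n)%N -> lacsum c n.+1 * lacsum d n.+1 = X * Y.
  move=> /M1P; set x := lacsum _ _; set y := lacsum _ _ => Dn.
  have e0 := lac_gt0 n; have e2 := lac_le_half n.
  apply/eqP; rewrite -subr_eq0; apply: contraT => ne0.
  have zI : (x * y - X * Y) / lac n ^+ 2 \is a Num.int.
    rewrite mulrBl rpredB//; last first.
      by rewrite rpredM// -exprVn rpredX// /lac exprVn invrK rpredX// (intr_int _ 2).
    by rewrite expr2 invfM mulrACA rpredM// lacsum_int.
  have /(norm_intr_ge1 zI) : (x * y - X * Y) / lac n ^+ 2 != 0.
    by rewrite mulf_neq0// invr_eq0 expf_eq0/= gt_eqF.
  rewrite normrM normfV (gtr0_norm (exprn_gt0 _ e0)) ler_pdivlMr ?exprn_gt0// mul1r.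
  move=> big; have := Xc n.+1; have := Yd n.+1; rewrite -/x -/y lacS => Yy Xx.
  (* Writing [y] as [Y - (Y - y)] lets its size be bounded by that of [Y] plus [C]. *)
  have E : x * y - X * Y = - (X * (Y - y) + (Y - (Y - y)) * (X - x)) by ring.
  have B1 : `|X * (Y - y)| <= `|X| * (C * lac n ^+ 3) by rewrite normrM ler_wpM2l.
  have e31 : lac n ^+ 3 <= 1 by rewrite exprn_ile1 ?ltW//; lra.
  have B2 : `|(Y - (Y - y)) * (X - x)| <= (`|Y| + C) * (C * lac n ^+ 3).
    rewrite normrM ler_pM// (le_trans (ler_normB _ _))// lerD2l (le_trans Yy)//.
    by rewrite ler_piMr.
  have := ler_normD (X * (Y - y)) ((Y - (Y - y)) * (X - x)).
  rewrite -normrN -E => B3.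
  have B4 : lac n ^+ 2 <= C * (`|X| + `|Y| + C) * lac n ^+ 3.
    apply: le_trans big _; apply: le_trans B3 _; apply: le_trans (lerD B1 B2) _.
    by rewrite le_eqVlt; apply/orP; left; apply/eqP; ring.
  have : C * (`|X| + `|Y| + C) * lac n ^+ 3 < lac n ^+ 2.
    by rewrite exprS mulrA gtr_pMl ?exprn_gt0.
  by rewrite ltNge B4.
(* Two consecutive equal products are compared at an index [n.+1] where [c] has a nonzero digit. *)
have [[|n]] := cio (Mx + My + M1 + M2).+1; first by [].
rewrite ltnS => nM cn0.
have x0 : lacsum c n.+1 != 0 by apply: xn0; lia.
have y0 : lacsum d n.+1 != 0 by apply: yn0; lia.
have e0 := lac_gt0 n; have e2 := lac_le_half n.
have := prodE n.+1; rewrite -(prodE n) ?[lacsum _ n.+2]lacsumS; try lia.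
move/(_ ltac:(lia)); rewrite lacS.
set x := lacsum c _ in x0 *; set y := lacsum d _ in y0 *.
set e := lac n in e0 e2 *; set a : R := (c _)%:~R; set b : R := (d _)%:~R => E.
have e3 : e ^+ 3 != 0 by rewrite expf_eq0/= gt_eqF.
have {}E : a * y + b * x + a * b * e ^+ 3 = 0.
  apply: (mulIf e3); rewrite mul0r.
  have -> : (a * y + b * x + a * b * e ^+ 3) * e ^+ 3 =
    (x + a * e ^+ 3) * (y + b * e ^+ 3) - x * y by ring.
  by rewrite E subrr.
(* In [E] the term [a * b * e ^+ 3] is too small to be a nonzero multiple of [e], so it vanishes
   together with [a * y + b * x]. As [a] is nonzero, [b = 0] and then [y = 0], a contradiction. *)
have zI : (a * y + b * x) / e \is a Num.int.
  by rewrite mulrDl -!mulrA rpredD// rpredM ?intr_int ?lacsum_int.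
have [z0|zn0] := eqVneq ((a * y + b * x) / e) 0.
  have ab : a * y + b * x = 0.
    by apply/eqP; move/eqP: z0; rewrite mulf_eq0 invr_eq0 (gt_eqF e0) orbF.
  move: E; rewrite ab add0r => /eqP; rewrite mulf_eq0 (negPf e3) orbF mulf_eq0.
  case/orP => [|/eqP b0]; first by rewrite intr_eq0 (negPf cn0).
  move: ab; rewrite b0 mul0r addr0 => /eqP; rewrite mulf_eq0 (negPf y0) orbF.
  by rewrite intr_eq0 (negPf cn0).
have := norm_intr_ge1 zI zn0.
have -> : (a * y + b * x) / e = - (a * b * e ^+ 2).
  apply: (mulIf (lt0r_neq0 e0)); rewrite divfK ?gt_eqF//.
  by apply/eqP; rewrite -subr_eq0; apply/eqP; rewrite -[RHS]E; ring.
rewrite normrN normrM normrM (ger0_norm (sqr_ge0 e)).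
have : `|a| * `|b| * e ^+ 2 <= C ^+ 2 * e ^+ 2.
  by rewrite ler_wpM2r ?sqr_ge0// expr2 ler_pM ?normr_ge0 ?cC ?dC.
have : C ^+ 2 * e ^+ 2 <= C ^+ 2 * e.
  by rewrite ler_wpM2l ?sqr_ge0// expr2 ler_piMl//; lra.
have := M2P n ltac:(lia); rewrite -/e; lra.
Qed.
End lacunary_series.

(** * Integer combinations of a family of vectors *)

Section integer_combinations.
Context {K : choiceType}.
Implicit Types (s t : seq (K * int)) (V : zmodType).

(** Indices may be repeated in [s], so that addition is concatenation; [coef], itself an [icomb],
    collects the multiplicity of an index. *)
Definition icomb V (f : K -> V) s : V := \sum_(p <- s) f p.1 *~ p.2.

Definition coef s (a : K) : int := icomb (fun b => (b == a)%:R) s.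

Definition icomb_opp s := [seq (p.1, - p.2) | p <- s].

Lemma icomb_cat V (f : K -> V) s t : icomb f (s ++ t) = icomb f s + icomb f t.
Proof. exact: big_cat. Qed.

Lemma icombN V (f : K -> V) s : icomb f (icomb_opp s) = - icomb f s.
Proof.
by rewrite /icomb big_map -sumrN; apply: eq_bigr => p _; rewrite mulrNz.
Qed.

Lemma icomb1 V (f : K -> V) a n : icomb f [:: (a, n)] = f a *~ n.
Proof. by rewrite /icomb big_seq1. Qed.

Lemma raddf_icomb V (W : zmodType) (h : {additive V -> W}) (f : K -> V) s :
  h (icomb f s) = icomb (h \o f) s.
Proof. by rewrite /icomb raddf_sum; apply: eq_bigr => p _; rewrite /= raddfMz. Qed.

Lemma icomb_coef V (f : K -> V) s :
  icomb f s = \sum_(a <- undup (unzip1 s)) f a *~ coef s a.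
Proof.
under eq_bigr do rewrite /coef /icomb mulrz_sumr.
rewrite exchange_big /=; apply: eq_big_seq => p ps.
have pu : p.1 \in undup (unzip1 s) by rewrite mem_undup map_f.
rewrite (bigD1_seq p.1) ?undup_uniq//= eqxx big1 ?addr0.
  by rewrite [1 *~ _]intz.
by move=> a /negPf; rewrite eq_sym => ->; rewrite mul0rz mulr0z.
Qed.

Lemma icomb_coef0 V (f : K -> V) s : coef s =1 (fun=> 0) -> icomb f s = 0.
Proof. by move=> s0; rewrite icomb_coef big1// => a _; rewrite s0 mulr0z. Qed.

Lemma ler_norm_icomb (R : numDomainType) (f : K -> R) (M : R) s :
  (forall a, `|f a| <= M) -> `|icomb f s| <= (\sum_(p <- s) `|p.2|%:~R) * M.
Proof.
move=> fM; rewrite /icomb mulr_suml; apply: le_trans (ler_norm_sum _ _ _) _.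
apply: ler_sum => p _; rewrite -mulrzl normrM intr_norm ler_wpM2l//.
Qed.

End integer_combinations.

(** * The numbers b_t and products of their integer combinations *)

Section jump_function.
Context {R : realType}.

Definition rat_enum (k : nat) : rat := odflt 0 (unpickle k).

Definition digit (t : R) (k : nat) : int := (ratr (rat_enum k) < t)%R%:R.

(** The digits are 0 or 1, so the partial sums are nondecreasing and their supremum is the sum b_t
    of the series. *)
Definition jump (t : R) : R := sup (range (lacsum (R := R) (digit t))).

(** If the index found is exactly [N], a second search strictly below its rational must give another
    index. *)
Lemma rat_enum_dense (N : nat) (t0 t1 : R) : t0 < t1 ->
  exists2 n, (N <= n)%N & t0 < ratr (rat_enum n) < t1.
Proof.
elim: N t0 t1 => [|N IHN] t0 t1 t01.
  have [q] := rat_in_itvoo t01; rewrite in_itv/= => qt.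
  by exists (pickle q); rewrite // /rat_enum pickleK.
have [n Nn /andP[n0 n1]] := IHN _ _ t01.
have [m Nm /andP[m0 m1]] := IHN _ _ n1.
have [nN|nN] := ltnP N n; first by exists n; rewrite // n0.
exists m; last by rewrite m1 (lt_trans n0).
rewrite ltn_neqAle Nm andbT; apply: contraL m0 => /eqP <-.
by rewrite -leNgt (_ : n = N) //; apply/eqP; rewrite eqn_leq nN.
Qed.

(** Each term is at most [2 * lac k - 2 * lac k.+1], because [2 * lac k ^+ 3 <= lac k]; these bounds
    telescope. *)
Lemma lacsum_digit_tail t m n : (n <= m)%N ->
  0 <= lacsum (R := R) (digit t) m - lacsum (R := R) (digit t) n <= 2 * lac n - 2 * lac m.
Proof.
move=> /subnK <-; elim: (m - n)%N => [|k /andP[IHl IHr]].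
  by rewrite add0n !subrr lexx.
have e0 := @lac_gt0 R (k + n); have e2 := @lac_le_half R (k + n).
have : 2 * lac (k + n) ^+ 3 <= lac (k + n) :> R.
  have h : lac (k + n) ^+ 2 <= 2^-1 :> R.
    by rewrite (le_trans _ e2)// exprS ler_piMr ?(ltW e0)//; lra.
  by rewrite exprS mulrCA ler_piMr ?(ltW e0)//; lra.
move: IHl IHr; rewrite addSn lacsumS lacS /digit.
by case: (_ < t) => /=; rewrite ?(mul0r, mul1r, addr0) => IHl IHr h;
  apply/andP; split; lra.
Qed.

Lemma jump_approx t n : `|jump t - lacsum (digit t) n| <= 2 * lac n.
Proof.
have ub : ubound (range (lacsum (R := R) (digit t))) (lacsum (digit t) n + 2 * lac n).
  move=> _ [m _ <-]; have em := @lac_gt0 R m; have en := @lac_gt0 R n.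
  by case: (leqP n m) => [|/ltnW] /(@lacsum_digit_tail t) /andP[]; lra.
have hs : has_sup (range (lacsum (R := R) (digit t))).
  by split; [exists (lacsum (digit t) 0), 0%N|exists (lacsum (digit t) n + 2 * lac n)].
have : lacsum (digit t) n <= jump t by apply: sup_upper_bound => //; exists n.
have : jump t <= lacsum (digit t) n + 2 * lac n by apply: ge_sup => //; case: hs.
by move=> h1 h2; rewrite ger0_norm; lra.
Qed.

Context {K : choiceType} (r : K -> R) (r_inj : injective r).

Let digits s k := icomb (fun a => digit (r a) k) s.

(* Just below the largest [r a] with nonzero coefficient, only the digit of [a]
   is nonzero. *)
Lemma digits_infinitely_often (s : seq (K * int)) (a0 : K) : coef s a0 != 0 ->
  forall N, exists2 n, (N <= n)%N & digits s n != 0.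
Proof.
move=> a00 N; pose u := undup (unzip1 s).
(* A gap below [t]: no [r b] with [b] in [v] lies strictly between [t0] and [t]. *)
have maxseq (v : seq K) (t : R) : exists2 t0, t0 < t &
    forall b, b \in v -> r b < t -> r b <= t0.
  elim: v => [|b v [t0 t0t vt0]]; first by exists (t - 1) => //; lra.
  have [bt|bt] := ltP (r b) t.
    exists (Num.max (r b) t0); first by rewrite gt_max bt t0t.
    move=> b'; rewrite inE le_max => /predU1P[->|b'v b't]; first by rewrite lexx.
    by rewrite vt0 ?orbT.
  by exists t0 => // b'; rewrite inE => /predU1P[->|/vt0//]; rewrite ltNge bt.
have [a [an0 amax]] : exists a, coef s a != 0 /\
    forall b, b \in u -> coef s b != 0 -> r b <= r a.
  elim: u => [|b v [a [an0 av]]]; first by exists a0.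
  have [bn0|b0] := boolP ((coef s b != 0) && (r a < r b)).
    case/andP: bn0 => bn0 ab; exists b; split => // b'.
    by rewrite inE => /predU1P[->//|b'v /(av _ b'v) /le_trans]; apply; apply: ltW.
  exists a; split => // b'; rewrite inE => /predU1P[-> bn0|]; last exact: av.
  by move: b0; rewrite bn0/= -leNgt.
have [t0 t0a ut0] := maxseq u (r a).
have [n Nn /andP[t0n na]] := rat_enum_dense N t0a.
exists n => //; rewrite /digits icomb_coef -/u.
have au : a \in u.
  apply: contraT => au; move: an0; rewrite /coef /icomb big_seq big1 ?eqxx// => p ps.
  case: eqP => [pa|_]; last by rewrite mul0rz.
  by move: au; rewrite mem_undup -pa map_f.
rewrite (bigD1_seq a) ?undup_uniq//= /digit na mulrzz mul1r.
rewrite big_seq_cond big1 ?addr0// => b /andP[bu ba].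
have [->|bn0] := eqVneq (coef s b) 0; first by rewrite mulr0z.
have rba : r b < r a by rewrite lt_neqAle (inj_eq r_inj) ba amax.
have := ut0 b bu rba => rbt0.
by rewrite ltNge (le_trans rbt0 (ltW t0n)) mul0rz.
Qed.

(** Combinations of jumps are lacunary series with bounded digits [digits s]. If neither is trivial,
    both have infinitely many nonzero digits and [lac_product_not_int] applies. *)
Lemma jump_product_not_int (s t : seq (K * int)) :
  icomb (jump \o r) s * icomb (jump \o r) t \is a Num.int ->
  coef s =1 (fun=> 0) \/ coef t =1 (fun=> 0).
Proof.
move=> stI; have [s0|sn0] := pselect (coef s =1 (fun=> 0)); first by left.
have [t0|tn0] := pselect (coef t =1 (fun=> 0)); first by right.
have {sn0} [a an0] : exists a, coef s a != 0.
  apply: contrapT => h; apply: sn0 => a; apply/eqP/negP => a0.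
  by apply: h; exists a; apply/negP.
have {tn0} [b bn0] : exists b, coef t b != 0.
  apply: contrapT => h; apply: tn0 => b; apply/eqP/negP => b0.
  by apply: h; exists b; apply/negP.
pose W (s : seq (K * int)) : R := \sum_(p <- s) `|p.2|%:~R.
have W0 s' : 0 <= W s' by apply: sumr_ge0 => p _; rewrite ler0z.
have cW s' k : `|(digits s' k)%:~R| <= W s'.
  rewrite /digits (raddf_icomb (intmul (1 : R))) -[leRHS]mulr1.
  apply: ler_norm_icomb => c /=.
  by rewrite /digit; case: (_ < r c); rewrite ?normr1// normr0.
have lW s' n : `|icomb (jump \o r) s' - lacsum (digits s') n| <= W s' * (2 * lac n).
  have -> : lacsum (digits s') n =
      icomb (V := R) (fun a => lacsum (digit (r a)) n) s'.
    rewrite /lacsum /icomb; 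
    transitivity (\sum_(p <- s') \sum_(k < n)
        ((digit (r p.1) k)%:~R * lac k : R) *~ p.2); last first.
      by apply: eq_bigr => p _; rewrite mulrz_suml.
    rewrite exchange_big/=; apply: eq_bigr => k _.
    rewrite /digits /icomb rmorph_sum mulr_suml; apply: eq_bigr => p _ /=.
    rewrite rmorphMz /= mulrzAl //.
  rewrite /icomb -sumrB.
  under eq_bigr do rewrite -mulrzBl.
  apply: (ler_norm_icomb (f := fun a => jump (r a) - lacsum (digit (r a)) n)) => c.
  exact: jump_approx.
(* This constant bounds both digit sequences, by [W], and both approximation errors, by
   [2 * W * lac n]. *)
have := lac_product_not_int (C := 2 * (W s + W t))
  _ _ (digits_infinitely_often an0) (digits_infinitely_often bn0) _ _.
move=> /(_ (icomb (jump \o r) s) (icomb (jump \o r) t)).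
rewrite stI => /(_ _ _ _ _)/wrap[].
- by move=> k; apply: le_trans (cW _ _) _; have := W0 s; have := W0 t; lra.
- by move=> k; apply: le_trans (cW _ _) _; have := W0 s; have := W0 t; lra.
- move=> n; apply: le_trans (lW _ _) _; rewrite mulrCA mulrA.
  rewrite ler_wpM2r ?(ltW (lac_gt0 _))//.
  by have := W0 t; lra.
- move=> n; apply: le_trans (lW _ _) _; rewrite mulrCA mulrA.
  rewrite ler_wpM2r ?(ltW (lac_gt0 _))//.
  by have := W0 s; lra.
- by [].
Qed.

End jump_function.

Lemma injective_card_le T U (f : T -> U) : injective f -> [set: T] #<= [set: U].
Proof.
move=> f_inj; have [g] : $|{injfun [set: T] >-> [set: U]}|.
  by apply/injfunPex; exists f => // x y _ _ /f_inj.
exact: inj_card_le.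
Qed.

(** * Subgroups of normed spaces *)

Section normed_subgroups.
Context {R : realType} {V : normedModType R}.
Implicit Types H : set V.

Lemma subgroup0 H : subgroup H -> H 0.
Proof. by case=> -[x Hx] HB; rewrite -(subrr x); exact: HB. Qed.

Lemma subgroupN H x : subgroup H -> H x -> H (- x).
Proof. by move=> Hs Hx; rewrite -sub0r; apply: Hs.2 => //; exact: subgroup0. Qed.

Lemma subgroupD H x y : subgroup H -> H x -> H y -> H (x + y).
Proof. by move=> Hs Hx Hy; rewrite -(opprK y); apply: Hs.2 => //; exact: subgroupN. Qed.

Lemma subgroupMn H x n : subgroup H -> H x -> H (x *+ n).
Proof.
move=> Hs Hx; elim: n => [|n IHn]; first exact: subgroup0.
by rewrite mulrS; exact: subgroupD.
Qed.

Definition norm_separated H (d : R) := forall x, H x -> x != 0 -> d <= `|x|.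

Lemma norm_separated_dist H d x y : subgroup H -> norm_separated H d ->
  H x -> H y -> `|x - y| < d -> x = y.
Proof.
move=> Hs Hd Hx Hy xy; apply/eqP; rewrite -subr_eq0; apply: contraTT xy => xy.
by rewrite -leNgt Hd//; exact: Hs.2.
Qed.

(** Two points of [H] within [d / 2] of [p] coincide. If [p] differed from such a point [h], a point
    of [H] closer to [p] than [h] would have to be [h] itself. *)
Lemma norm_separated_closed H d : subgroup H -> 0 < d -> norm_separated H d -> closed H.
Proof.
move=> Hs d0 Hd p clHp.
have approx (e : R) : 0 < e -> exists2 h, H h & `|p - h| < e.
  move=> e0; have [h [Hh]] := clHp _ (nbhsx_ballx p e e0).
  by rewrite -ball_normE => ph; exists h.
have [h Hh ph] := approx (d / 2) (divr_gt0 d0 (ltr0n _ 2)).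
have [->//|neq] := eqVneq p h.
have [] := approx (Num.min `|p - h| (d / 2)).
  by rewrite lt_min normr_gt0 subr_eq0 neq divr_gt0.
move=> h' Hh'; rewrite lt_min => /andP[ph'h ph'].
suff hh' : h = h' by move: ph'h; rewrite hh' ltxx.
apply: norm_separated_dist Hd _ _ _ => //.
rewrite -(subrKA p) (le_lt_trans (ler_normD _ _))// distrC [ltRHS]splitr ltrD//.
Qed.

Lemma norm_separated_discrete H d :
  subgroup H -> 0 < d -> norm_separated H d -> discrete_set H.
Proof.
move=> Hs d0 Hd p Hp; split; first exact/mem_set.
exists (ball p d); first exact: nbhsx_ballx.
apply/seteqP; split=> [q [] + Hq|_ ->]; last by split=> //; exact: ballxx.
by rewrite -ball_normE => /(norm_separated_dist Hs Hd Hp Hq).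
Qed.

Lemma Q_hull_subgroup H : subgroup (Q_hull H).
Proof.
split; first by exists 0 => S [[]].
move=> x y Hx Hy S SH; have [[S0 SD SZ] HS] := SH.
apply: SD; first exact: Hx.
have := SZ (- 1) _ (Hy _ SH).
by rewrite raddfN/= rmorph1 scaleN1r.
Qed.

Lemma sub_Q_hull H : H `<=` Q_hull H.
Proof. by move=> x Hx S [_]; exact. Qed.

Lemma Q_hullZ H (q : rat) x : Q_hull H x -> Q_hull H (ratr q *: x).
Proof. by move=> Hx S SH; have [[_ _ SZ] _] := SH; apply: SZ; exact: Hx. Qed.

(** The vectors with a positive multiple in [H] form a rational subspace containing [H]. *)
Lemma Q_hull_multiple H x : subgroup H -> Q_hull H x ->
  exists2 n, (0 < n)%N & H (x *+ n).
Proof.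
move=> Hs /(_ [set y | exists2 n, (0 < n)%N & H (y *+ n)]); apply.
split; last by move=> y Hy; exists 1%N.
split=> [|y z [m m0 Hm] [n n0 Hn]|q y [n n0 Hn]].
- by exists 1%N; rewrite // mul0rn; exact: subgroup0.
- exists (m * n)%N; first by rewrite muln_gt0 m0.
  rewrite mulrnDl mulrnA mulnC mulrnA.
  by apply: subgroupD => //; exact: subgroupMn.
- exists (`|denq q| * n)%N; first by rewrite muln_gt0 n0 absz_gt0 denq_neq0.
  rewrite -scaler_nat scalerA natrM.
  have -> : `|denq q|%N%:R * n%:R * ratr q = n%:R * (numq q)%:~R :> R.
    rewrite [`|denq q|%N%:R]pmulrn absz_denq /ratr -mulrA mulrC mulrA divfK//.
    by rewrite intr_eq0 denq_neq0.
  rewrite mulrC -scalerA scaler_nat; case: (numq q) => k.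
    by rewrite -pmulrn scaler_nat; exact: subgroupMn.
  by rewrite NegzE mulrNz scaleNr scaler_nat; apply: subgroupN => //; exact: subgroupMn.
Qed.

Definition norm_inj_pm H := forall x y, H x -> H y -> `|x| = `|y| -> x = y \/ x = - y.

Lemma norm_inj_pm_Q_hull H : subgroup H -> norm_inj_pm H -> norm_inj_pm (Q_hull H).
Proof.
move=> Hs Hpm x y /(Q_hull_multiple Hs)[m m0 Hx] /(Q_hull_multiple Hs)[n n0 Hy] xy.
have mn0 : (m * n)%:R != 0 :> R by rewrite pnatr_eq0 -lt0n muln_gt0 m0.
have Hxmn : H (x *+ (m * n)) by rewrite mulrnA; exact: subgroupMn.
have Hymn : H (y *+ (m * n)) by rewrite mulnC mulrnA; exact: subgroupMn.
have [|E|E] := Hpm _ _ Hxmn Hymn; first by rewrite !normrMn xy.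
  by left; apply: (scalerI mn0); rewrite !scaler_nat.
by right; apply: (scalerI mn0); rewrite !scaler_nat mulNrn.
Qed.

Lemma dense_approx (S : set V) :
  (forall x e, 0 < e -> exists2 s, S s & `|x - s| < e) -> dense S.
Proof.
move=> Sx O [x Ox] oO.
have /nbhs_ballP[e e0 eO] : nbhs x O by exact: open_nbhs_nbhs.
have [s Ss xs] := Sx x _ e0.
by exists s; split=> //; apply: eO; rewrite -ball_normE.
Qed.

Lemma closure_approx (S : set V) x :
  closure S x <-> forall e, 0 < e -> exists2 s, S s & `|x - s| < e.
Proof.
split=> [Sx e e0|h B /nbhs_ballP[e e0 eB]].
  have [s [Ss]] := Sx _ (nbhsx_ballx x e e0).
  by rewrite -ball_normE; exists s.
have [s Ss xs] := h _ e0; exists s; split=> //.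
by apply: eB; rewrite -ball_normE.
Qed.

Lemma closure_Q_hullD H x y : closure (Q_hull H) x -> closure (Q_hull H) y ->
  closure (Q_hull H) (x + y).
Proof.
move=> /closure_approx Hx /closure_approx Hy; apply/closure_approx => e e0.
have e20 : 0 < e / 2 by rewrite divr_gt0.
have [s Hs xs] := Hx _ e20; have [t Ht yt] := Hy _ e20.
exists (s + t); first exact: subgroupD (Q_hull_subgroup H) Hs Ht.
by rewrite opprD addrACA (le_lt_trans (ler_normD _ _))// [ltRHS]splitr ltrD.
Qed.

(** First [x] is approximated by [s], then [a] by a rational [q] to a precision depending on [s];
    each term of [a *: (x - s) + (a - q) *: s] stays below [e / 2]. *)
Lemma closure_Q_hullZ H (a : R) x : closure (Q_hull H) x -> closure (Q_hull H) (a *: x).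
Proof.
move=> /closure_approx Hx; apply/closure_approx => e e0.
have e20 : 0 < e / 2 by rewrite divr_gt0.
have [s Hs xs] := Hx (e / 2 / (1 + `|a|)) (divr_gt0 e20 (ltr_pwDl ltr01 (normr_ge0 _))).
have s1 : 0 < 1 + `|s| by rewrite ltr_pwDl.
have [q] := @rat_in_itvoo _ (a - e / 2 / (1 + `|s|)) (a + e / 2 / (1 + `|s|))
  ltac:(by rewrite ltrD2l gtrN// divr_gt0).
rewrite in_itv/= -ltr_distlC => aq.
exists (ratr q *: s); first exact: Q_hullZ.
rewrite (_ : _ - _ = a *: (x - s) + (a - ratr q) *: s); last first.
  by rewrite scalerBr scalerBl addrA subrK.
rewrite (le_lt_trans (ler_normD _ _))// [ltRHS]splitr !normrZ ltr_leD//.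
  move: xs; rewrite ltr_pdivlMr ?ltr_pwDl// => /(le_lt_trans _); apply.
  by rewrite mulrC ler_wpM2l// lerDr.
move: aq; rewrite ltr_pdivlMr// => /ltW /(le_trans _); apply.
by rewrite ler_wpM2l// lerDr.
Qed.

End normed_subgroups.

(** A radius is the norm of some [a - b] in [H]. A point [z] of the sphere around [c] has [z - c] of
    the same norm, so [z] is [c + (a - b)] or [c - (a - b)], and these are at distance twice the
    radius. *)
Lemma Banakh_subgroup_norm_inj (R : realType) (K : choiceType) (H : set (l2 R K)) :
  subgroup H -> norm_inj_pm H -> Banakh_subgroup H.
Proof.
move=> Hs Hpm; split=> // c r [a [b ->]].
have distE (x y : H) : mdist x y = `|set_val x - set_val y| by [].
have Hv (x : H) : H (set_val x) by exact: set_valP.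
have Hab : H (set_val a - set_val b) by apply: Hs.2.
pose x : H := SigSub (mem_set (subgroupD Hs (Hv c) Hab)).
pose y : H := SigSub (mem_set (Hs.2 _ _ (Hv c) Hab)).
have xE : set_val x = set_val c + (set_val a - set_val b) by rewrite set_valE.
have yE : set_val y = set_val c - (set_val a - set_val b) by rewrite set_valE.
exists x, y; split; last first.
  by rewrite !distE xE yE opprB addrC addrA subrK -mulr2n normrMn mulr_natl.
apply/seteqP; split=> z; rewrite /sphere/= distE.
  move=> /(Hpm _ _ (Hs.2 _ _ (Hv z) (Hv c)) Hab) [] E; [left|right]; apply/val_inj.
    by move: xE; rewrite -E addrC subrK !set_valE.
  by move: yE; rewrite -E addrC subrK !set_valE.
by case=> ->; rewrite distE ?xE ?yE addrC addKr ?normrN.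
Qed.

(** * Construction of the lattice *)

Section l2_coordinates.
Context {R : realType} {K : choiceType}.
Implicit Types (x : l2 R K) (f : K -> R).

Lemma sumsq_finite_support f (u : seq K) : uniq u ->
  (forall a, a \notin u -> f a = 0) -> sumsq f = (\sum_(a <- u) f a ^+ 2)%:E.
Proof.
move=> uu fu; rewrite /sumsq (esumID [set` u]); last first.
  by move=> i _; rewrite lee_fin sqr_ge0.
rewrite setTI setTI [X in (_ + X)%E]esum1 ?adde0; last first.
  by move=> a /= /negP/fu ->; rewrite expr0n.
rewrite esum_fset//; last by move=> i _; rewrite lee_fin sqr_ge0.
by rewrite -fsbig_seq// sumEFin.
Qed.

(** Named so as to carry an additive structure, which lets [raddf_icomb] apply to coordinates. *)
Definition coord (a : K) x : R := x a.
Arguments coord : simpl never.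

Lemma coord_is_additive a : zmod_morphism (coord a).
Proof. by []. Qed.

HB.instance Definition _ a :=
  GRing.isZmodMorphism.Build (l2 R K) R (coord a) (coord_is_additive a).

Lemma coordZ a (t : R) x : coord a (t *: x) = t * coord a x.
Proof. by []. Qed.

Lemma coordD a x y : coord a (x + y) = coord a x + coord a y.
Proof. by []. Qed.

Lemma norm_sumsq x : (`|x| ^+ 2)%:E = sumsq x.
Proof. by rewrite sumsqE. Qed.

Lemma coord_le_norm a x : `|coord a x| <= `|x|.
Proof.
have := sqr_le_sumsq x a; rewrite -norm_sumsq lee_fin -(real_normK (num_real _)).
by rewrite ler_pXn2r ?nnegrE.
Qed.

Definition l2_of f : l2 R K := insubd 0 f.

Lemma l2_ofE f a : (sumsq f < +oo)%E -> coord a (l2_of f) = f a.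
Proof. by move=> foo; rewrite /coord /l2_of val_insubd unfold_in foo. Qed.

Definition unit_vec (a : K) : l2 R K := l2_of (fun c => (c == a)%:R).

Lemma coord_unit_vec a c : coord c (unit_vec a) = (c == a)%:R.
Proof.
apply: l2_ofE; rewrite (sumsq_finite_support (u := [:: a])) ?ltry//.
by move=> b; rewrite inE => /negPf ->.
Qed.

(** A finite subsum within [e ^+ 2] of [sumsq x] gives the support. The truncation [y] agrees with
    [x] there and vanishes elsewhere, so the squared norm of [x - y] is the remainder. *)
Lemma finite_support_approx x (e : R) : 0 < e ->
  exists u : seq K, `|x - \sum_(a <- u) coord a x *: unit_vec a| < e.
Proof.
move=> e0; have e20 : 0 < e ^+ 2 by rewrite exprn_gt0.
have [_ [A [/finite_seqP[s ->] _] <-]] := ub_ereal_sup_adherent e20 (sumsq_fin x).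
rewrite -/(esum _ _) -/(sumsq x) (_ : [set` s] = [set` undup s]); last first.
  by apply/seteqP; split=> a /=; rewrite mem_undup.
rewrite -fsbig_seq ?undup_uniq// sumEFin => near_x.
exists (undup s); set u := undup s in near_x *; set y := \sum_(a <- _) _.
have yE a : coord a y = if a \in u then coord a x else 0.
  rewrite /y raddf_sum; under eq_bigr do rewrite /= coordZ coord_unit_vec.
  case: ifPn => au.
    rewrite (bigD1_seq a) ?undup_uniq//= eqxx mulr1 big1 ?addr0// => b.
    by rewrite eq_sym => /negPf ->; rewrite mulr0.
  rewrite big_seq big1// => b bu; case: eqP => [ab|_]; last by rewrite mulr0.
  by move: au; rewrite ab bu.
have xyE : sumsq x = ((\sum_(a <- u) coord a x ^+ 2)%:E + sumsq (x - y)%R)%E.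
  pose f a := if a \in u then coord a x else 0.
  transitivity ((\sum_(a <- u) f a ^+ 2)%:E + sumsq (x - y)%R)%E; last first.
    by congr (_%:E + _)%E; apply: eq_big_seq => a au; rewrite /f au.
  rewrite -(sumsq_finite_support (f := f)) ?undup_uniq//; last first.
    by move=> a /negPf au; rewrite /f au.
  rewrite /sumsq -esumD; last 2 first.
  - by move=> a _; rewrite lee_fin sqr_ge0.
  - by move=> a _; rewrite lee_fin sqr_ge0.
  apply: eq_esum => a _; rewrite -[(x - y) a]/(coord a (x - y)) raddfB /= yE -EFinD.
  by rewrite /f; case: ifP; rewrite ?subrr ?subr0 expr0n ?addr0 ?add0r.
move: near_x; rewrite xyE -norm_sumsq; rewrite -!EFinD lte_fin => lt.
rewrite -(@ltr_pXn2r _ 2)// ?nnegrE ?(ltW e0)//.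
by move: lt; rewrite -ltrBrDl; lra.
Qed.

End l2_coordinates.

(** * The group [H]: norms, separation, density of the hull, cardinality *)

Section lattice.
Context {R : realType} {K : choiceType} (r : K -> R) (r_inj : injective r) (k0 : K).

Let b (a : K) : R := jump (r a).

Definition lattice_basis (a : K) : l2 R K :=
  if a == k0 then b k0 *: unit_vec k0 else unit_vec a + b a *: unit_vec k0.

Let v := lattice_basis.

Definition lattice : set (l2 R K) := range (icomb v).

Lemma coord0_icomb s : coord k0 (icomb v s) = icomb b s.
Proof.
rewrite raddf_icomb; apply: eq_bigr => p _ /=; congr (_ *~ _).
rewrite /v /lattice_basis; case: eqP => [->|/eqP pk].
  by rewrite coordZ coord_unit_vec eqxx mulr1.
by rewrite coordD coordZ !coord_unit_vec eqxx eq_sym (negPf pk) add0r mulr1.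
Qed.

Lemma coord_icomb a s : a != k0 -> coord a (icomb v s) = (coef s a)%:~R.
Proof.
move=> ak; rewrite raddf_icomb [RHS](raddf_icomb (intmul (1 : R))).
apply: eq_bigr => p _ /=; congr (_ *~ _).
rewrite /v /lattice_basis; case: eqP => [->|/eqP pk].
  by rewrite coordZ coord_unit_vec (negPf ak) mulr0 eq_sym (negPf ak).
rewrite coordD coordZ !coord_unit_vec (negPf ak) mulr0 addr0 eq_sym.
by case: (_ == _).
Qed.

Lemma norm_icomb s : exists n : int, `|icomb v s| ^+ 2 = icomb b s ^+ 2 + n%:~R.
Proof.
pose u := [seq a <- undup (unzip1 s) | a != k0].
exists (\sum_(a <- u) coef s a ^+ 2); apply: EFin_inj.
rewrite norm_sumsq (sumsq_finite_support (u := k0 :: u)).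
- rewrite big_cons -[icomb v s k0]/(coord k0 _) coord0_icomb rmorph_sum/=.
  congr (_ + _)%:E; apply: eq_big_seq => a.
  rewrite mem_filter => /andP[ak _].
  by rewrite -[icomb v s a]/(coord a _) coord_icomb// rmorphXn.
- by rewrite /= mem_filter eqxx filter_uniq ?undup_uniq.
- move=> a; rewrite inE negb_or mem_filter => /andP[ak]; rewrite ak/= mem_undup => au.
  rewrite -[LHS]/(coord a _) coord_icomb// /coef /icomb big_seq big1// => p ps.
  by case: eqP => [pa|]; [move: au; rewrite -pa map_f|rewrite mul0rz].
Qed.

(** The [k0] coordinate is a combination of jumps whose square is the integer 0. *)
Lemma icomb_eq0 s : icomb v s = 0 -> coef s =1 (fun=> 0).
Proof.
move=> s0; have := jump_product_not_int r_inj (s := s) (t := s).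
by rewrite -/b -coord0_icomb s0 raddf0 mul0r rpred0 => /(_ isT)[].
Qed.

Lemma lattice_basis_in a : lattice (v a).
Proof. by exists [:: (a, 1)]; rewrite // icomb1 mulr1z. Qed.

Lemma lattice_subgroup : subgroup lattice.
Proof.
split; first by exists (v k0); exact: lattice_basis_in.
move=> _ _ [s _ <-] [t _ <-]; exists (s ++ icomb_opp t) => //.
by rewrite icomb_cat icombN.
Qed.

(* |icomb v s|^2 = (icomb b s)^2 + integer, so equal norms make
   icomb b (s - t) * icomb b (s + t) an integer. *)
Lemma lattice_norm_inj_pm : norm_inj_pm lattice.
Proof.
move=> _ _ [s _ <-] [t _ <-] st.
have [m ms] := norm_icomb s; have [n nt] := norm_icomb t.
have := jump_product_not_int r_inj (s := s ++ icomb_opp t) (t := s ++ t).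
rewrite !icomb_cat icombN -subr_sqr -/b.
rewrite (_ : _ - _ = (n - m)%:~R); last first.
  by move/(congr1 (fun z => z ^+ 2)): st; rewrite ms nt intrB; lra.
rewrite intr_int => /(_ isT)[] /(icomb_coef0 v); rewrite icomb_cat ?icombN.
  by move/subr0_eq; left.
by move/addr0_eq/(congr1 -%R); rewrite opprK; right.
Qed.

Lemma jump_neq0 : b k0 != 0.
Proof.
apply/eqP => b0; have := icomb_eq0 (s := [:: (k0, 1)]).
rewrite icomb1 /v /lattice_basis eqxx b0 scale0r mul0rz => /(_ erefl k0).
by rewrite /coef icomb1 eqxx.
Qed.

(** A nonzero coefficient off [k0] is an integer coordinate, of size at least 1. Otherwise the
    vector is a nonzero integer multiple of [v k0]. *)
Lemma lattice_norm_separated : norm_separated lattice (Num.min 1 `|b k0|).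
Proof.
move=> _ [s _ <-] s0.
have [[a [ak an0]]|sk] := pselect (exists a, a != k0 /\ coef s a != 0).
  apply: (@le_trans _ _ 1); first by rewrite ge_min lexx.
  apply: le_trans (coord_le_norm a _); rewrite coord_icomb//.
  by rewrite norm_intr_ge1 ?intr_int ?intr_eq0.
have {}sk a : a != k0 -> coef s a = 0.
  by move=> ak; apply/eqP; apply: contrapT => /negP an0; apply: sk; exists a.
have bE : icomb b s = b k0 *~ coef s k0.
  have [su|su] := boolP (k0 \in undup (unzip1 s)).
    rewrite icomb_coef (bigD1_seq k0) ?undup_uniq//= big1 ?addr0// => a /sk ->.
    by rewrite mulr0z.
  rewrite (_ : coef s k0 = 0); last first.
    rewrite /coef /icomb big_seq big1// => p ps.
    case: eqP => [pk|]; last by rewrite mul0rz.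
    by move: su; rewrite mem_undup -pk map_f.
  rewrite mulr0z icomb_coef big_seq big1// => a au; rewrite sk//.
  by apply: contraNneq su => <-.
have kn0 : coef s k0 != 0.
  apply: contra_neq s0 => k0E; apply: icomb_coef0 => a.
  by have [->|/sk] := eqVneq a k0.
apply: (@le_trans _ _ `|b k0|); first by rewrite ge_min lexx orbT.
apply: le_trans (coord_le_norm k0 _); rewrite coord0_icomb bE -mulrzr normrM.
by rewrite ler_peMr// norm_intr_ge1 ?intr_int ?intr_eq0.
Qed.

(** The closure admits real scalars: rescaling [v k0] gives [unit_vec k0], whose multiple by [b a]
    is then subtracted from [v a]. *)
Lemma unit_vec_closure a : closure (Q_hull lattice) (unit_vec a).
Proof.
have vC c : closure (Q_hull lattice) (v c).
  by apply: subset_closure; apply: sub_Q_hull; exact: lattice_basis_in.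
have e0 : closure (Q_hull lattice) (unit_vec k0).
  have := closure_Q_hullZ (a := (b k0)^-1) (vC k0).
  by rewrite /v /lattice_basis eqxx scalerA mulVf ?scale1r// jump_neq0.
have [->//|ak] := eqVneq a k0.
have := closure_Q_hullD (vC a) (closure_Q_hullZ (a := - b a) e0).
by rewrite /v /lattice_basis (negPf ak) scaleNr addrK.
Qed.

Lemma lattice_hull_dense : dense (Q_hull lattice).
Proof.
apply: dense_approx => x e e_gt0.
have e2 : 0 < e / 2 by rewrite divr_gt0.
have [u xu] := finite_support_approx x e2.
have : closure (Q_hull lattice) (\sum_(a <- u) coord a x *: unit_vec a).
  elim/big_ind : _ => [|y z|a _]; [|exact: closure_Q_hullD|].
    by apply: subset_closure; exact: subgroup0 (Q_hull_subgroup lattice).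
  exact/closure_Q_hullZ/unit_vec_closure.
move=> /closure_approx/(_ _ e2)[s Hs ys]; exists s => //.
move: xu ys; set y := \sum_(a <- u) _ => xu ys.
by rewrite -(subrKA y) (le_lt_trans (ler_normD _ _))// [ltRHS]splitr ltrD.
Qed.

Lemma lattice_basis_inj : injective v.
Proof.
move=> a c ac; have := icomb_eq0 (s := [:: (a, 1); (c, -1)]).
rewrite /icomb !big_cons big_nil addr0 /= mulr1z mulrN1z ac subrr => /(_ erefl a).
rewrite /coef /icomb !big_cons big_nil addr0 /= eqxx.
by case: eqP => [->//|_]; rewrite mul0rz.
Qed.

Lemma lattice_infinite : [set: nat] #<= lattice.
Proof.
have [f] : $|{injfun [set: nat] >-> lattice}|; last exact: inj_card_le.
apply/injfunPex; exists (fun n => v k0 *+ n).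
  by move=> n _; exact: subgroupMn lattice_subgroup (lattice_basis_in k0).
move=> m n _ _ /(congr1 (coord k0)); rewrite !raddfMn/=.
rewrite /v /lattice_basis eqxx coordZ coord_unit_vec eqxx mulr1.
by move=> /(mulrIn jump_neq0).
Qed.

(** Above, the lattice is an image of the lists over [K * int], which inject into [K] if [K] is
    infinite and are countable if [K] is countable. Below, [v] is injective and the multiples of
    [v k0] are infinitely many. *)
Lemma lattice_card : card_eq_max lattice [set: K] [set: nat].
Proof.
have Hseq : lattice #<= [set: seq (K * int)] by exact: card_image_le.
split=> [/infiniteP Kinf|/pcard_injP[f /in2TT f_inj]].
  rewrite card_eq_le; apply/andP; split.
    have [f f_inj] := infinite_seq_inj Kinf.
    exact: card_le_trans Hseq (injective_card_le f_inj).
  have [g] : $|{injfun [set: K] >-> lattice}|; last exact: inj_card_le.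
  apply/injfunPex; exists v; first by move=> a _; exact: lattice_basis_in.
  by move=> a c _ _; exact: lattice_basis_inj.
apply: eq_card_nat; last exact/infiniteP/lattice_infinite.
pose g (s : seq (K * int)) := [seq (f p.1, p.2) | p <- s].
have g_inj : injective g by apply: inj_map => -[a m] [c n] [/f_inj-> ->].
apply: card_le_trans Hseq _; apply: card_le_trans (injective_card_le g_inj) _.
exact: countableP.
Qed.

End lattice.

Theorem theorem15p1 (R : realType) (K : choiceType)
    (K_neq0 : [set: K] !=set0) (K_le_c : [set: K] #<= [set: R]) :
  exists H : set (l2 R K),
    [/\ closed H, discrete_set H, Banakh_subgroup H,
        card_eq_max H [set: K] [set: nat] &
        dense (Q_hull H) /\ Banakh_subgroup (Q_hull H)].
Proof.
(* The bound by the continuum supplies the distinct reals [r a]. *)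
have [k0 _] := K_neq0; have /pcard_injP[r /in2TT r_inj] := K_le_c.
have Hs := lattice_subgroup r k0.
have Hpm := lattice_norm_inj_pm r_inj (k0 := k0).
have Hd := @lattice_norm_separated R K r k0.
have d_gt0 : 0 < Num.min 1 `|jump (r k0)|.
  by rewrite lt_min ltr01 normr_gt0 jump_neq0.
exists (lattice r k0); split.
- exact: norm_separated_closed Hs d_gt0 Hd.
- exact: norm_separated_discrete Hs d_gt0 Hd.
- exact: Banakh_subgroup_norm_inj.
- exact: lattice_card.
- split; first exact: lattice_hull_dense.
  by apply: Banakh_subgroup_norm_inj (Q_hull_subgroup _) _; exact: norm_inj_pm_Q_hull.
Qed.
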